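(* For every fixed $c\ge 1$ there exist constants $C_0,C_1,n_0>0$ such that the following holds for every fixed $0<\beta<1/2$. Consider any sequence of parameters $(n,M,R,\varepsilon,T)$ (sequence index suppressed) with $n\to\infty$, $n\ge n_0$, $M,R>0$, $0<\varepsilon<MR/C_1$, and $$T=o\left[\left(\frac{2nMR}{\varepsilon}\right)^c\right].$$ Then, for all sufficiently late members of the sequence, $$\Delta_{\mathcal F_{\rm Lip}^M(B_R)}(\varepsilon,\beta,T)\le C_0\,\mathcal R_c(C_1\varepsilon;M,2R,n).$$ Consequently, up to constants and logarithmic factors (powers of $\log(nMR/\varepsilon)$), $$\Delta_{\mathcal F_{\rm Lip}^M(B_R)}(\varepsilon,\beta,T)\lesssim\max\left\{\frac{\varepsilon^2}{\sqrt n\,MR},\frac{\varepsilon}{n}\right\}.$$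
   Context: $B_R=\{x\in\mathbb R^n:\|x\|_2\le R\}$. $\mathcal F_{\rm Lip}^M(B_R)$ is the class of convex $M$-Lipschitz functions $f:B_R\to\mathbb R$. Noisy oracle: for $f:S\to\mathbb R$, $S\subset\mathbb R^n$, $\delta\ge0$, let $\mathsf O_\delta(f)=\{O:S\to\mathbb R:\ \sup_{x\in S}|O(x)-f(x)|\le\delta\}$. Solvability: algorithms query points of $S$ and output a point of $S$. A randomized adaptive algorithm $A$ making at most $T$ oracle calls $(\varepsilon,\beta,\delta,T)$-solves a class $\mathcal F$ of functions on $S$ if for every $f\in\mathcal F$ and every deterministic oracle $O\in\mathsf O_\delta(f)$ its output $A^O$ satisfies $\mathbb P_A\{f(A^O)-\inf_S f\le\varepsilon\}\ge1-\beta$, the probability being over the internal randomness of $A$ (deterministic adaptive algorithms are included). The maximum admissible level of noise is $\Delta_{\mathcal F}(\varepsilon,\beta,T)=\sup\{\delta:\ \text{there is }A\text{ that }(\varepsilon,\beta,\delta,T)\text{-solves }\mathcal F\}$. For $c\ge1$, $$\mathcal R_c(\varepsilon;M,D,n)=\max\left\{\frac{\varepsilon^2}{\sqrt n\,MD},\frac{\varepsilon}{n}\right\}\left(13c\log\frac{nMD}{\varepsilon}\right)^2.$$ Convention: $T=o(Q)$ means $T/Q\to0$ along the sequence of parameters. All constants are independent of the particular sequence. *)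

(* Defs.v *)
From HB Require Import structures.
From mathcomp Require Import all_boot all_order all_algebra.
From mathcomp Require Import all_classical all_reals all_analysis.

Set Implicit Arguments.
Unset Strict Implicit.
Unset Printing Implicit Defensive.

Import Order.TTheory GRing.Theory Num.Theory.
Import numFieldNormedType.Exports.

Local Open Scope classical_set_scope.
Local Open Scope ring_scope.

(* Points of [R^n] are row vectors; the norm [`|x|] the library puts on them is
   the sup norm, hence this separate Euclidean norm. *)
Definition norm2 {R : realType} {n : nat} (x : 'rV[R]_n) : R :=
  Num.sqrt (\sum_(i < n) x 0 i ^+ 2).

Definition ball2 {R : realType} (n : nat) (r : R) : set 'rV[R]_n :=
  [set x | norm2 x <= r].
Arguments ball2 {R} n r.

(* A function on [S : set X] is represented by a total function on [X] of which
   only the values on [S] matter: the class below only constrains these values,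
   and so do [noisy_oracle] and [solves]. *)
Definition convex_lipschitz {R : realType} (n : nat) (M r : R) :
    set ('rV[R]_n -> R) :=
  [set f | convex_function (ball2 n r) f /\
           forall x y, ball2 n r x -> ball2 n r y ->
             `|f x - f y| <= M * norm2 (x - y)].
Arguments convex_lipschitz {R} n M r.

Definition noisy_oracle {R : realType} {X : Type} (S : set X) (delta : R)
    (f : X -> R) : set (X -> R) :=
  [set O | forall x, S x -> `|O x - f x| <= delta].

(* Deterministic adaptive algorithms as decision trees: either stop with an
   output, or query a point and continue depending on the answer. *)
Inductive algorithm (X V : Type) : Type :=
| Output of X
| Query of X & (V -> algorithm X V).

Fixpoint run {X V : Type} (O : X -> V) (A : algorithm X V) : X :=
  match A with
  | Output x => x
  | Query x next => run O (next (O x))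
  end.

(* All queried points and outputs lie in [S], with at most [T] queries. *)
Fixpoint admissible {X V : Type} (S : set X) (T : nat) (A : algorithm X V) :
    Prop :=
  match A, T with
  | Output x, _ => S x
  | Query _ _, 0%N => False
  | Query x next, T'.+1 => S x /\ forall v, admissible S T' (next v)
  end.

(* A randomized algorithm is a family of deterministic ones indexed by a
   probability space [(W, P)]. As the oracle is an arbitrary function, the
   success event need not be measurable; "probability at least [1 - beta]"
   is therefore required of some measurable event [E] contained in it, which for
   a measurable success event amounts to its own probability being at least
   [1 - beta]. *)
Definition solves {R : realType} {X : Type} (S : set X) (F : set (X -> R))
    (eps beta delta : R) (T : nat) {d : measure_display} {W : measurableType d}
    (P : probability W R) (A : W -> algorithm X R) : Prop :=
  (forall w, admissible S T (A w)) /\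
  forall f, F f -> forall O, noisy_oracle S delta f O ->
    exists E : set W,
      [/\ measurable E,
          E `<=` [set w | f (run O (A w)) - inf (f @` S) <= eps] &
          ((1 - beta)%:E <= P E)%E].

(* The supremum is taken in the extended reals: it is [+oo] if the admissible
   levels are unbounded, and [-oo] if no level is admissible. *)
Definition max_noise {R : realType} {X : Type} (S : set X) (F : set (X -> R))
    (eps beta : R) (T : nat) : \bar R :=
  ereal_sup [set delta%:E | delta in [set delta : R | 0 <= delta /\
    exists (d : measure_display) (W : measurableType d) (P : probability W R)
      (A : W -> algorithm X R), solves S F eps beta delta T P A]].

Definition rate {R : realType} (c eps M D : R) (n : nat) : R :=
  Num.max (eps ^+ 2 / (Num.sqrt n%:R * M * D)) (eps / n%:R) *
  (13 * c * ln (n%:R * M * D / eps)) ^+ 2.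

(* Main.v *)
(** The minimiser is hidden in a direction [w] drawn from the vertices
    [(+-1, ..., +-1) / sqrt n] of a cube. For a fixed [x], the inequality
    [|<w, x>| <= t |x|] fails for a fraction of at most [2 exp (- n t^2 / 8)] of
    the directions. Let [h x] be the supremum of [<u, x>] over the [u] in the
    unit ball with [|<w, u>| <= t]; it equals [|x|] where the inequality holds,
    but is at most [r t] at [r w]. The convex function
      [max (m h x - k <w, x> - g) (2 m h x - b)]
    with [b = 4 eps], [k = 3 eps / r], [g = k t b / m] is then within [2 g] of
    the radial function [max (m |x|) (2 m |x| - b)] where the inequality holds,
    and at most [- 2 eps] at [r w]. An oracle answering with the radial
    function there says nothing about [w] until a query violates the
    inequality, and any [eps]-optimal point violates it.

    With [t^2 = 8 c ln (2 n M r / eps) / n] the algorithm fails for at least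
    half of the directions, and [m = min (M / 2) (eps / (r t))] makes [2 g] the
    maximum of [48 eps^2 t / (r M)] and [24 eps t^2]. When [t > 1 / 6],
    [108 eps t^2] exceeds [3 eps], a noise level at which two opposite linear
    functions are indistinguishable. *)
Require Import Defs.
From HB Require Import structures.
From mathcomp Require Import all_boot all_order all_algebra.
From mathcomp Require Import all_classical all_reals all_analysis.
From mathcomp Require Import measurable_realfun ring lra.

Import Order.TTheory GRing.Theory Num.Theory.
Import numFieldNormedType.Exports.

Local Open Scope classical_set_scope.
Local Open Scope ring_scope.

(** * Averaging over a finite family of instances *)

(* Union bound over the queries and the output of the run against [g]. *)
Lemma sum_run_le {R : realType} {X V : Type} {I : finType} (S : set X)
    (g : X -> V) (O : I -> X -> V) (B G : I -> pred X) (q : R) :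
  (forall i x, S x -> ~~ B i x -> O i x = g x) ->
  (forall x, S x -> \sum_i (B i x)%:R <= q) ->
  (forall i x, S x -> G i x -> B i x) ->
  forall (T : nat) (A : algorithm X V), admissible S T A ->
    \sum_i (G i (run (O i) A))%:R <= T.+1%:R * q.
Proof.
move=> OB Bq GB T A; elim: A T => [x|x next IH] T /=.
  have le_sum (Sx : S x) : \sum_i (G i x)%:R <= q.
    apply: le_trans (Bq x Sx); apply: ler_sum => i _.
    by case: (boolP (G i x)) => [/(GB _ _ Sx) ->|_]; rewrite ?ler0n.
  have q0 (Sx : S x) : 0 <= q by apply: le_trans (le_sum Sx); exact: sumr_ge0.
  move=> adm; have {adm} Sx : S x by case: T adm.
  apply: le_trans (le_sum Sx) _.
  by rewrite ler_peMl ?q0// ler1n.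
case: T => // T [Sx adm].
(* Every index outside [B] at [x] receives the answer [g x] and so follows the same subtree
   [next (g x)]; the others are charged to this query, at cost at most [q]. The output accounts for
   the [+1] in [T.+1]. *)
have := IH (g x) T (adm (g x)) => leT.
rewrite -natr1 mulrDl mul1r.
apply: le_trans (lerD leT (Bq x Sx)).
rewrite -big_split/=; apply: ler_sum => i _.
have [Bix|nB] := boolP (B i x); last by rewrite (OB i x)// addr0.
by rewrite -natrD ler_nat (leq_trans (leq_b1 _))// leq_addl.
Qed.

(** The averaging half of Yao's principle: the number of instances on which a random tree succeeds
    is at most [K] for every outcome, hence in expectation, while each instance contributes at least
    [1 - beta] to this expectation. *)
Lemma solves_sum_le {R : realType} {X : Type} {I : finType} {S : set X}
    {F : set (X -> R)} {eps beta delta : R} {T : nat} {d : measure_display}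
    {W : measurableType d} {P : probability W R} {A : W -> algorithm X R}
    (f O : I -> X -> R) (K : R) :
  solves S F eps beta delta T P A ->
  (forall i, F (f i)) -> (forall i, noisy_oracle S delta (f i) (O i)) ->
  (forall a, admissible S T a ->
    \sum_i (f i (run (O i) a) - inf (f i @` S) <= eps)%R%:R <= K) ->
  #|I|%:R * (1 - beta) <= K.
Proof.
move=> [adm sol] Ff Of leK.
have [E EP] := choice (fun i => sol _ (Ff i) _ (Of i)).
have mE i : measurable (E i) by have [] := EP i.
have le_sum : (\sum_(i : I) P (E i) <= K%:E)%E.
  have -> : (\sum_(i : I) P (E i) =
      \int[P]_(w in setT) \sum_(i : I) (\1_(E i) w)%:E)%E.
    rewrite ge0_integral_sum//.
    - by apply: eq_bigr => i _; rewrite integral_indic// setIT.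
    - by move=> i; apply/measurable_EFinP; exact: measurable_indic.
  have -> : K%:E = (\int[P]_(w in setT) cst K%:E w)%E.
    by rewrite integral_cst//= probability_setT mule1.
  apply: ge0_le_integral => //.
  - by move=> w _; apply: sume_ge0 => i _; rewrite lee_fin.
  - apply: emeasurable_sum => i.
    by apply/measurable_EFinP; exact: measurable_indic.
  - move=> w _; rewrite sumEFin lee_fin; apply: le_trans (leK _ (adm w)).
    apply: ler_sum => i _; rewrite indicE; have [_ EG _] := EP i.
    case: (boolP (w \in E i)) => [/set_mem/EG/= ->//|_].
    by rewrite ler0n.
rewrite -lee_fin; apply: le_trans le_sum.
rewrite mulr_natl -sumr_const -sumEFin.
by apply: lee_sum => i _; have [] := EP i.
Qed.

(** * A sub-Gaussian bound for a random sign *)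

(** The exponent is weaker than the sharp [y ^+ 2 / 2], so [1 + z <= expR z] suffices: large [y]
    satisfy [|y| <= 2 * y ^+ 2], and small ones give [2 / (1 - y ^+ 2) <= 2 * (1 + 2 * y ^+ 2)]. *)
Lemma cosh_le {R : realType} (y : R) :
  expR y + expR (- y) <= 2 * expR (2 * y ^+ 2).
Proof.
have [y2|y2] := leP (1 / 2) `|y|.
  have le_exp (z : R) : `|z| = `|y| -> expR z <= expR (2 * y ^+ 2).
    move=> zy; rewrite ler_expR (le_trans (ler_norm z))// zy.
    rewrite -(real_normK (num_real y)).
    have := normr_ge0 y; nra.
  by rewrite mulr_natl mulr2n lerD ?le_exp// normrN.
have le_inv (z : R) : z < 1 -> expR z <= (1 - z)^-1.
  move=> z1; have := expR_ge1Dx (- z); rewrite expRN => h.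
  by rewrite -[leLHS]invrK lef_pV2 ?posrE ?invr_gt0 ?expR_gt0 ?subr_gt0.
move: y2; rewrite ltr_norml => /andP[y1 y2].
have e1 : expR y <= (1 - y)^-1 by apply: le_inv; lra.
have e2 : expR (- y) <= (1 + y)^-1.
  by rewrite -[y in leRHS]opprK; apply: le_inv; lra.
have y4 : y ^+ 2 < 1 / 4 by nra.
apply: le_trans (lerD e1 e2) _.
have -> : (1 - y)^-1 + (1 + y)^-1 = 2 * (1 - y ^+ 2)^-1.
  by field; rewrite !lt0r_neq0//; lra.
rewrite ler_pM2l//; apply: le_trans (expR_ge1Dx _).
rewrite -div1r ler_pdivrMr; nra.
Qed.

(** * Euclidean inner product and norm *)

Definition dot {R : realType} {n : nat} (u x : 'rV[R]_n) : R :=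
  \sum_(i < n) u 0 i * x 0 i.

Lemma dotC {R : realType} {n : nat} (u x : 'rV[R]_n) : dot u x = dot x u.
Proof. by apply: eq_bigr => i _; rewrite mulrC. Qed.

Lemma dotDr {R : realType} {n : nat} (u x y : 'rV[R]_n) :
  dot u (x + y) = dot u x + dot u y.
Proof. by rewrite -big_split; apply: eq_bigr => i _; rewrite !mxE mulrDr. Qed.

Lemma dotZr {R : realType} {n : nat} (u x : 'rV[R]_n) (a : R) :
  dot u (a *: x) = a * dot u x.
Proof. by rewrite mulr_sumr; apply: eq_bigr => i _; rewrite !mxE mulrCA. Qed.

Lemma dotZl {R : realType} {n : nat} (u x : 'rV[R]_n) (a : R) :
  dot (a *: u) x = a * dot u x.
Proof. by rewrite dotC dotZr dotC. Qed.

Lemma dotNr {R : realType} {n : nat} (u x : 'rV[R]_n) :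
  dot u (- x) = - dot u x.
Proof. by rewrite -scaleN1r dotZr mulN1r. Qed.

Lemma dotBr {R : realType} {n : nat} (u x y : 'rV[R]_n) :
  dot u (x - y) = dot u x - dot u y.
Proof. by rewrite dotDr dotNr. Qed.

Lemma dotBl {R : realType} {n : nat} (u v x : 'rV[R]_n) :
  dot (u - v) x = dot u x - dot v x.
Proof. by rewrite dotC dotBr ![dot x _]dotC. Qed.

Lemma dot0l {R : realType} {n : nat} (x : 'rV[R]_n) : dot 0 x = 0.
Proof. by rewrite -[X in dot X _](scale0r 0) dotZl mul0r. Qed.

Lemma norm2_ge0 {R : realType} {n : nat} (x : 'rV[R]_n) : 0 <= norm2 x.
Proof. exact: sqrtr_ge0. Qed.

Lemma dotxx {R : realType} {n : nat} (x : 'rV[R]_n) : dot x x = norm2 x ^+ 2.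
Proof. by rewrite sqr_sqrtr ?sumr_ge0// => i _; rewrite sqr_ge0. Qed.

Lemma norm2Z {R : realType} {n : nat} (a : R) (x : 'rV[R]_n) :
  norm2 (a *: x) = `|a| * norm2 x.
Proof.
apply/eqP; rewrite -(eqrXn2 (n := 2))// ?mulr_ge0 ?norm2_ge0//.
by rewrite -dotxx dotZl dotZr dotxx exprMn real_normK ?num_real// mulrA.
Qed.

Lemma norm2N {R : realType} {n : nat} (x : 'rV[R]_n) : norm2 (- x) = norm2 x.
Proof. by rewrite -scaleN1r norm2Z normrN1 mul1r. Qed.

Lemma norm2_eq0 {R : realType} {n : nat} (x : 'rV[R]_n) : norm2 x = 0 -> x = 0.
Proof.
move=> x0; have /eqP := dotxx x; rewrite x0 expr0n/= psumr_eq0; last first.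
  by move=> i _; rewrite -expr2 sqr_ge0.
move=> /allP x0'; apply/rowP => i; rewrite mxE; apply/eqP.
by have := x0' i; rewrite mem_index_enum mulf_eq0 orbb; apply.
Qed.

Lemma dot_le_norm2 {R : realType} {n : nat} (u x : 'rV[R]_n) :
  norm2 u <= 1 -> dot u x <= norm2 x.
Proof.
move=> u1; have [/norm2_eq0 ->|x0] := eqVneq (norm2 x) 0.
  by rewrite -[X in dot _ X](scale0r 0) dotZr mul0r norm2_ge0.
have x_gt0 : 0 < norm2 x by rewrite lt0r x0 norm2_ge0.
(* Cauchy-Schwarz, by expanding this square. *)
have : 0 <= dot (norm2 x *: u - x) (norm2 x *: u - x).
  by rewrite dotxx sqr_ge0.
rewrite dotBr !dotBl !dotZr !dotZl !dotxx [dot x u]dotC => h.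
have u0 := norm2_ge0 u; have u2 : norm2 u ^+ 2 <= 1 by rewrite expr_le1.
rewrite -(ler_pM2l x_gt0); nra.
Qed.

Lemma normr_dot_le_norm2 {R : realType} {n : nat} (u x : 'rV[R]_n) :
  norm2 u <= 1 -> `|dot u x| <= norm2 x.
Proof.
move=> u1; rewrite ler_norml dot_le_norm2// andbT lerNl -dotNr -norm2N.
exact: dot_le_norm2.
Qed.

(** * Concentration over the vertices of the cube *)

Definition sign_vector {R : realType} {n : nat} (s : {ffun 'I_n -> bool}) :
    'rV[R]_n :=
  \row_i ((-1) ^+ s i / Num.sqrt n%:R).

Lemma norm2_sign_vector {R : realType} {n : nat} (s : {ffun 'I_n -> bool}) :
  (0 < n)%N -> norm2 (sign_vector s : 'rV[R]_n) = 1.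
Proof.
move=> n0; rewrite /norm2; under eq_bigr => i _.
  rewrite mxE exprMn sqrr_sign mul1r exprVn sqr_sqrtr ?ler0n//. over.
rewrite sumr_const card_ord -[_ *+ n]mulr_natr mulVf ?sqrtr1//.
by rewrite pnatr_eq0 -lt0n.
Qed.

(** The exponential of a sum factors over the coordinates, so the sum over all sign patterns is a
    product of [n] two-term sums, each bounded by [cosh_le]. *)
Lemma sum_expR_dot_sign_vector {R : realType} {n : nat} (a : R) (x : 'rV[R]_n) :
  \sum_(s : {ffun 'I_n -> bool}) expR (a * dot (sign_vector s) x)
  <= 2 ^+ n * expR (2 * a ^+ 2 / n%:R * norm2 x ^+ 2).
Proof.
pose F (i : 'I_n) (b : bool) : R :=
  expR (a * ((-1) ^+ b / Num.sqrt n%:R * x 0 i)).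
under eq_bigr => s _.
  rewrite /dot mulr_sumr expR_sum.
  under eq_bigr => i _ do rewrite mxE -/(F i (s i)).
  over.
rewrite -(bigA_distr_bigA F) -dotxx /dot mulr_sumr expR_sum.
rewrite -[2 ^+ n](_ : \prod_(i < n) 2 = _); last by rewrite prodr_const card_ord.
rewrite -big_split/=; apply: ler_prod => i _; apply/andP; split.
  by apply: sumr_ge0 => b _; exact: expR_ge0.
rewrite big_bool/= /F expr1 expr0.
set y := a * (1 / _ * _).
have -> : a * (-1 / Num.sqrt n%:R * x 0 i) = - y by rewrite /y; ring.
rewrite addrC; apply: le_trans (cosh_le y) _.
rewrite (_ : 2 * y ^+ 2 = 2 * a ^+ 2 / n%:R * (x 0 i * x 0 i))//.
rewrite /y !exprMn exprVn sqr_sqrtr ?ler0n// expr1n; ring.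
Qed.

Lemma dot_sign_vector_tail {R : realType} {n : nat} (t : R) (x : 'rV[R]_n) :
  (0 < n)%N -> 0 <= t ->
  \sum_(s : {ffun 'I_n -> bool}) (t * norm2 x < dot (sign_vector s) x)%R%:R
  <= 2 ^+ n * expR (- (n%:R * t ^+ 2 / 8)).
Proof.
move=> n0 t0; have nR : 0 < n%:R :> R by rewrite ltr0n.
have [/norm2_eq0 ->|x0] := eqVneq (norm2 x) 0.
  rewrite big1 ?mulr_ge0 ?exprn_ge0 ?expR_ge0// => s _.
  by rewrite -[X in dot _ X](scale0r 0) dotZr mul0r ltNge mulr_ge0// norm2_ge0.
have x_gt0 : 0 < norm2 x by rewrite lt0r x0 norm2_ge0.
(* Chernoff's method; this [a] minimises the exponent [2 * a ^+ 2 / n * norm2 x ^+ 2 - a * t * norm2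
   x], with minimum [- n * t ^+ 2 / 8]. *)
pose a := n%:R * t / (4 * norm2 x).
have a0 : 0 <= a by rewrite divr_ge0 ?mulr_ge0// norm2_ge0.
pose e := expR (- (a * (t * norm2 x))).
apply: (@le_trans _ _ (\sum_(s : {ffun 'I_n -> bool})
    e * expR (a * dot (sign_vector s) x))).
  apply: ler_sum => s _; case: ltP => h; last first.
    by rewrite mulr_ge0 ?expR_ge0.
  rewrite -expRD -[leLHS]expR0 ler_expR addrC subr_ge0.
  by rewrite ler_wpM2l// ltW.
rewrite -mulr_sumr; apply: le_trans.
  by apply: ler_wpM2l (sum_expR_dot_sign_vector a x); exact: expR_ge0.
rewrite mulrCA ler_wpM2l ?exprn_ge0// -expRD ler_expR le_eqVlt.
by apply/orP; left; apply/eqP; rewrite /a; field; rewrite x0 lt0r_neq0.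
Qed.

Lemma normr_dot_sign_vector_tail {R : realType} {n : nat} (t : R)
    (x : 'rV[R]_n) :
  (0 < n)%N -> 0 <= t ->
  \sum_(s : {ffun 'I_n -> bool}) (t * norm2 x < `|dot (sign_vector s) x|)%R%:R
  <= 2 * 2 ^+ n * expR (- (n%:R * t ^+ 2 / 8)).
Proof.
move=> n0 t0; rewrite -mulrA mulr_natl mulr2n.
apply: le_trans; last first.
  by apply: lerD; [exact: (dot_sign_vector_tail t x)
                  |exact: (dot_sign_vector_tail t (- x))].
rewrite -big_split/=; apply: ler_sum => s _.
rewrite norm2N dotNr lter_normr -natrD ler_nat.
by case: (_ < dot _ _); case: (_ < - dot _ _).
Qed.

(** * The support function of a slab of the unit ball *)

(** As a support function of a subset of the unit ball, it is convex and 1-Lipschitz, yet small in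
    the direction [w] that the slab cuts off. *)
Definition slab_support {R : realType} {n : nat} (t : R) (w x : 'rV[R]_n) : R :=
  sup [set dot u x | u in [set u | norm2 u <= 1 /\ `|dot w u| <= t]].

Lemma slab_support_le {R : realType} {n : nat} (t : R) (w x : 'rV[R]_n)
    (a : R) :
  0 <= t -> (forall u, norm2 u <= 1 -> `|dot w u| <= t -> dot u x <= a) ->
  slab_support t w x <= a.
Proof.
move=> t0 le_a; apply: ge_sup; last by move=> _ [u [u1 ut] <-]; exact: le_a.
(* For [0 <= t] the slab contains the origin, so the real [sup] is taken over a nonempty set. *)
exists (dot 0 x), 0 => //; split; last by rewrite dotC dot0l normr0.
by rewrite -(scale0r 0) norm2Z normr0 mul0r.
Qed.

Lemma slab_support_ge {R : realType} {n : nat} (t : R) (w x u : 'rV[R]_n) :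
  norm2 u <= 1 -> `|dot w u| <= t -> dot u x <= slab_support t w x.
Proof.
move=> u1 ut; apply: ub_le_sup; last by exists u.
by exists (norm2 x) => _ [v [v1 _] <-]; exact: dot_le_norm2.
Qed.

Lemma slab_support_norm2 {R : realType} {n : nat} (t : R) (w x : 'rV[R]_n) :
  0 <= t -> `|dot w x| <= t * norm2 x -> slab_support t w x = norm2 x.
Proof.
move=> t0 xt; apply/le_anti/andP; split.
  by apply: slab_support_le => // u u1 _; exact: dot_le_norm2.
have [x0|x0] := eqVneq (norm2 x) 0.
  rewrite x0 -(dot0l x); apply: slab_support_ge.
    by rewrite -(scale0r 0) norm2Z normr0 mul0r.
  by rewrite dotC dot0l normr0.
have x_gt0 : 0 < norm2 x by rewrite lt0r x0 norm2_ge0.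
(* The maximiser over the whole unit ball, [x / norm2 x], lies in the slab by hypothesis. *)
rewrite [leLHS](_ : _ = dot ((norm2 x)^-1 *: x) x).
  apply: slab_support_ge.
    by rewrite norm2Z ger0_norm ?invr_ge0 ?norm2_ge0// mulVf.
  by rewrite dotZr normrM ger0_norm ?invr_ge0 ?norm2_ge0// mulrC ler_pdivrMr.
by rewrite dotZl dotxx expr2 mulKf.
Qed.

Lemma slab_support_scale_le {R : realType} {n : nat} (t r : R) (w : 'rV[R]_n) :
  0 <= t -> 0 <= r -> slab_support t w (r *: w) <= r * t.
Proof.
move=> t0 r0; apply: slab_support_le => // u _ ut.
by rewrite dotZr dotC ler_wpM2l// (le_trans (ler_norm _)).
Qed.

Lemma slab_support_lipschitz {R : realType} {n : nat} (t : R)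
    (w x y : 'rV[R]_n) :
  0 <= t -> slab_support t w x <= slab_support t w y + norm2 (x - y).
Proof.
move=> t0; apply: slab_support_le => // u u1 ut.
rewrite -(subrK y x) dotDr addrC addrK lerD ?dot_le_norm2//.
exact: slab_support_ge.
Qed.

Lemma slab_support_convex {R : realType} {n : nat} (t a b : R)
    (w x y : 'rV[R]_n) :
  0 <= t -> 0 <= a -> 0 <= b ->
  slab_support t w (a *: x + b *: y) <=
  a * slab_support t w x + b * slab_support t w y.
Proof.
move=> t0 a0 b0; apply: slab_support_le => // u u1 ut.
by rewrite dotDr !dotZr lerD// ler_wpM2l//; exact: slab_support_ge.
Qed.

(** * The hard functions and the oracle that conceals them *)

(** The tilt [k * dot w x] can grow with [norm2 x]; the steeper, untilted second piece overrides it
    at large radius, so that it shows only where it is bounded. *)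
Definition hard_function {R : realType} {n : nat} (m k g b t : R)
    (w x : 'rV[R]_n) : R :=
  Num.max (m * slab_support t w x - k * dot w x - g)
          (2 * m * slab_support t w x - b).

Definition radial_oracle {R : realType} {n : nat} (m b : R) (x : 'rV[R]_n) : R :=
  Num.max (m * norm2 x) (2 * m * norm2 x - b).

(** Both pieces are convex with slope at most [2 * m], the first one because [m + k <= 2 * m]. *)
Lemma hard_function_convex_lipschitz {R : realType} {n : nat}
    (M r m k g b t : R) (w : 'rV[R]_n) :
  0 <= t -> 0 <= k -> k <= m -> 2 * m <= M -> norm2 w <= 1 ->
  convex_lipschitz n M r (hard_function m k g b t w).
Proof.
move=> t0 k0 km mM w1; have m0 : 0 <= m by apply: le_trans km.
split.
  move=> l x y _ _; rewrite convRE /conv/=.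
  have a0 : 0 <= l%:num by [].
  have b0 : 0 <= 1 - l%:num by rewrite subr_ge0.
  rewrite -[unstable.onem l%:num]/(1 - l%:num).
  move: (l%:num) a0 b0 => a a0 b0.
  have /(ler_wpM2l m0) := slab_support_convex t a (1 - a) w x y t0 a0 b0.
  rewrite /hard_function dotDr !dotZr.
  set h := slab_support t w x; set h' := slab_support t w y.
  set d := dot w x; set d' := dot w y => le_h.
  have max1 (p q : R) : p <= Num.max p q by rewrite le_max lexx.
  have max2 (p q : R) : q <= Num.max p q by rewrite le_max lexx orbT.
  rewrite ge_max; apply/andP; split.
    apply: (@le_trans _ _ (a * (m * h - k * d - g)
                           + (1 - a) * (m * h' - k * d' - g))).
      lra.
    by rewrite lerD// ler_wpM2l.
  apply: (@le_trans _ _ (a * (2 * m * h - b) + (1 - a) * (2 * m * h' - b))).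
    lra.
  by rewrite lerD// ler_wpM2l.
suff le_f x y : hard_function m k g b t w x <=
    hard_function m k g b t w y + M * norm2 (x - y).
  move=> x y _ _; rewrite ler_norml lerBlDl le_f andbT lerNl opprB lerBlDl.
  by rewrite -[x - y]opprB norm2N.
have h := slab_support_lipschitz t w x y t0.
have dw := normr_dot_le_norm2 w (x - y) w1.
have N0 := norm2_ge0 (x - y).
move: dw; rewrite dotBr ler_norml => /andP[dw _].
rewrite /hard_function ge_max; apply/andP; split.
  apply: (@le_trans _ _ (m * slab_support t w y - k * dot w y - g
      + M * norm2 (x - y))); last by rewrite lerD2r le_max lexx.
  nra.
apply: (@le_trans _ _ (2 * m * slab_support t w y - b
    + M * norm2 (x - y))); last by rewrite lerD2r le_max lexx orbT.
nra.
Qed.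

Lemma radial_oracle_error {R : realType} {n : nat} (m k b t : R)
    (w x : 'rV[R]_n) :
  0 <= t -> 0 < m -> 0 <= k -> 0 <= b -> k * t <= m ->
  `|dot w x| <= t * norm2 x ->
  `|radial_oracle m b x - hard_function m k (k * t * b / m) b t w x|
    <= 2 * (k * t * b / m).
Proof.
move=> t0 m0 k0 b0 ktm xt; rewrite /hard_function slab_support_norm2//.
rewrite /radial_oracle; have s0 := norm2_ge0 x.
set s := norm2 x in xt s0 *; set d := dot w x in xt *.
set g := k * t * b / m.
have gm : g * m = k * t * b by rewrite /g divfK ?gt_eqF.
have g0 : 0 <= g by rewrite /g divr_ge0 ?mulr_ge0// ltW.
move: xt; rewrite ler_norml => /andP[d1 d2].
have kd1 : - (k * t * s) <= k * d by have := ler_wpM2l k0 d1; lra.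
have kd2 : k * d <= k * t * s by have := ler_wpM2l k0 d2; lra.
clearbody g d s.
have [ms|ms] := leP (m * s) b.
  have : k * t * s * m <= g * m
    by rewrite gm; have := ler_wpM2l (mulr_ge0 k0 t0) ms; lra.
  rewrite ler_pM2r// => ktsg.
  rewrite max_l; last lra.
  rewrite ler_norml; apply/andP; split.
    rewrite lerNl opprB lerBlDr ge_max; apply/andP; split; lra.
  rewrite lerBlDr -lerBlDl le_max; apply/orP; left; lra.
rewrite max_r; last lra.
rewrite max_r; first by rewrite subrr normr0 mulr_ge0.
rewrite -(ler_pM2r m0) !mulrBl; nra.
Qed.

(** Here the tilt is at most [k * t * norm2 x], which the radial term [m * norm2 x] absorbs. *)
Lemma hard_function_outside_cone {R : realType} {n : nat} (m k g b t : R)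
    (w x : 'rV[R]_n) :
  0 <= t -> 0 <= k -> k * t <= m -> `|dot w x| <= t * norm2 x ->
  - g <= hard_function m k g b t w x.
Proof.
move=> t0 k0 ktm xt; rewrite /hard_function slab_support_norm2// le_max.
apply/orP; left; have s0 := norm2_ge0 x.
move: xt; rewrite ler_norml => /andP[_ xt].
suff : k * dot w x <= m * norm2 x by lra.
apply: (@le_trans _ _ (k * (t * norm2 x))); first exact: ler_wpM2l.
by rewrite mulrA ler_wpM2r.
Qed.

(** At [r *: w] the support function is at most [r * t], which bounds the pieces by [e - 3 * e] and
    [2 * e - 4 * e]. *)
Lemma hard_function_scale_le {R : realType} {n : nat} (m k g b t r e : R)
    (w : 'rV[R]_n) :
  0 <= t -> 0 <= m -> 0 <= r -> 0 <= g -> norm2 w = 1 ->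
  m * (r * t) <= e -> 3 * e <= k * r -> 4 * e <= b ->
  hard_function m k g b t w (r *: w) <= - (2 * e).
Proof.
move=> t0 m0 r0 g0 w1 me kr be.
have := slab_support_scale_le t r w t0 r0.
move=> /(ler_wpM2l m0) h.
rewrite /hard_function dotZr dotxx w1 expr1n mulr1 ge_max.
apply/andP; split; lra.
Qed.

Lemma inf_image_le {R : realType} {n : nat} (M r : R) (f : 'rV[R]_n -> R)
    (x : 'rV[R]_n) :
  0 <= M -> convex_lipschitz n M r f -> ball2 n r x ->
  inf (f @` ball2 n r) <= f x.
Proof.
move=> M0 [_ fM] xr; apply: ge_inf; last by exists x.
have r0 : 0 <= r by apply: le_trans xr; exact: norm2_ge0.
have z0 : norm2 (0 : 'rV[R]_n) = 0 by rewrite -(scale0r 0) norm2Z normr0 mul0r.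
(* The Lipschitz condition bounds the image from below, so that its real [inf] is a genuine
   infimum. *)
exists (f 0 - M * r) => _ [y yr <-].
have := fM 0 y; rewrite /ball2/= z0 => /(_ r0 yr).
rewrite sub0r norm2N ler_norml => /andP[_ h].
have : M * norm2 y <= M * r by apply: ler_wpM2l.
lra.
Qed.

(** * Impossibility at small angle and at large noise *)

Lemma not_solves_small_angle {R : realType} {n : nat} (M r eps t beta delta : R)
    (T : nat) {d : measure_display} {W : measurableType d}
    (P : probability W R) (A : W -> algorithm 'rV[R]_n R) :
  (0 < n)%N -> 0 < M -> 0 < r -> 0 < eps -> 6 * eps <= M * r ->
  0 < t -> t <= 1 / 6 -> beta < 1 / 2 ->
  4 * T.+1%:R * expR (- (n%:R * t ^+ 2 / 8)) <= 1 ->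
  48 * eps ^+ 2 * t / (r * M) <= delta -> 24 * eps * t ^+ 2 <= delta ->
  ~ solves (ball2 n r) (convex_lipschitz n M r) eps beta delta T P A.
Proof.
move=> n0 M0 r0 eps0 Mr t0 t6 beta2 Te delta1 delta2 sol.
pose m := Num.min (M / 2) (eps / (r * t)).
pose k := 3 * eps / r; pose b := 4 * eps; pose g := k * t * b / m.
have rt0 : 0 < r * t by rewrite mulr_gt0.
have m0 : 0 < m by rewrite lt_min !divr_gt0.
have k0 : 0 <= k by rewrite divr_ge0 ?mulr_ge0// ltW.
have b0 : 0 <= b by rewrite mulr_ge0// ltW.
(* The two terms of the minimum are handled by [6 * eps <= M * r] and [t <= 1 / 6] respectively. *)
have km : k <= m.
  rewrite le_min /k; apply/andP; split.
    by rewrite ler_pdivrMr//; lra.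
  rewrite ler_pdivlMr// (_ : _ * (r * t) = 3 * eps * t).
    by have := ler_wpM2l (ltW eps0) t6; lra.
  by field; rewrite gt_eqF.
have mM : 2 * m <= M.
  have : m <= M / 2 by rewrite ge_min lexx.
  lra.
have mrt : m * (r * t) <= eps by rewrite -ler_pdivlMr// ge_min lexx orbT.
have ktm : k * t <= m by apply: le_trans km; rewrite ler_piMr//; lra.
have mr : 3 * eps <= m * r by rewrite -ler_pdivrMr.
have gE : g * (r * m) = 12 * eps ^+ 2 * t.
  by rewrite /g /k /b; field; rewrite !gt_eqF.
have rm0 : 0 < r * m by rewrite mulr_gt0.
have g0 : 0 <= g := divr_ge0 (mulr_ge0 (mulr_ge0 k0 (ltW t0)) b0) (ltW m0).
(* This separates the values [>= - g] outside the cone from the value [<= - 2 * eps] at [r *: w] by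
   more than [eps]. *)
have g_lt : g < eps.
  rewrite -(ltr_pM2r rm0) gE.
  have := ler_wpM2l (ltW eps0) mr.
  have : eps ^+ 2 * t <= eps ^+ 2 * (1 / 6) by rewrite ler_wpM2l ?sqr_ge0.
  have : 0 < eps ^+ 2 by rewrite exprn_gt0.
  lra.
have g_delta : 2 * g <= delta.
  rewrite (_ : 2 * g = 24 * eps ^+ 2 * t / (r * m)); last first.
    by rewrite /g /k /b; field; rewrite !gt_eqF.
  rewrite /m; case: (leP (M / 2) (eps / (r * t))) => _;
    [apply: le_trans delta1|apply: le_trans delta2].
    by rewrite le_eqVlt; apply/orP; left; apply/eqP; field; rewrite !gt_eqF.
  by rewrite le_eqVlt; apply/orP; left; apply/eqP; field; rewrite !gt_eqF.
pose w (s : {ffun 'I_n -> bool}) : 'rV[R]_n := sign_vector s.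
have w1 s : norm2 (w s) = 1 by exact: norm2_sign_vector.
pose f s := hard_function m k g b t (w s).
pose B (s : {ffun 'I_n -> bool}) (x : 'rV[R]_n) :=
  t * norm2 x < `|dot (w s) x|.
pose O s x := if B s x then f s x else radial_oracle m b x.
have Ff s : convex_lipschitz n M r (f s).
  by apply: hard_function_convex_lipschitz; rewrite ?w1// ltW.
have Of s : noisy_oracle (ball2 n r) delta (f s) (O s).
  move=> x _; rewrite /O; case: (boolP (B s x)) => [_|].
    by rewrite subrr normr0 (le_trans _ g_delta)// mulr_ge0.
  rewrite /B -leNgt => xt; apply: le_trans g_delta.
  by apply: radial_oracle_error => //; exact: ltW.
pose K := 2 * 2 ^+ n * expR (- (n%:R * t ^+ 2 / 8)).
(* The right-hand side is at most half the number of directions, whereas [1 - beta] exceeds one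
   half. *)
suff : #|{ffun 'I_n -> bool}|%:R * (1 - beta) <= T.+1%:R * K.
  rewrite card_ffun card_bool card_ord natrX /K.
  have p0 : 0 < 2 ^+ n :> R by rewrite exprn_gt0.
  rewrite [leRHS](_ : _ = 2 ^+ n *
    (4 * T.+1%:R * expR (- (n%:R * t ^+ 2 / 8)) / 2)); last by field.
  rewrite ler_pM2l//; lra.
apply: (solves_sum_le f O _ sol Ff Of).
apply: (sum_run_le (ball2 n r) (radial_oracle m b) O B
  (fun s x => f s x - inf (f s @` ball2 n r) <= eps)).
- by move=> s x _ /negbTE nB; rewrite /O nB.
- by move=> x _; apply: normr_dot_sign_vector_tail => //; exact: ltW.
- move=> s x _; apply: contraTT; rewrite /B -leNgt -ltNge => xt.
  have rw : ball2 n r (r *: w s).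
    by rewrite /ball2/= norm2Z w1 mulr1 ger0_norm// ltW.
  have := inf_image_le M r (f s) (r *: w s) (ltW M0) (Ff s) rw.
  have : f s (r *: w s) <= - (2 * eps).
    apply: hard_function_scale_le; rewrite ?w1 ?(ltW t0) ?(ltW m0) ?(ltW r0)//.
    by rewrite /k divfK ?gt_eqF.
  have := hard_function_outside_cone m k g b t (w s) x (ltW t0) k0 ktm xt.
  rewrite -/(f s x); lra.
Qed.

Lemma linear_convex_lipschitz {R : realType} {n : nat} (M r a : R)
    (w : 'rV[R]_n) :
  norm2 w <= 1 -> `|a| <= M -> convex_lipschitz n M r (fun x => a * dot w x).
Proof.
move=> w1 aM; split.
  move=> l x y _ _; rewrite convRE /conv/= dotDr !dotZr le_eqVlt.
  by apply/orP; left; apply/eqP; ring.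
move=> x y _ _; rewrite -mulrBr -dotBr normrM ler_pM//.
exact: normr_dot_le_norm2.
Qed.

Lemma not_solves_large_noise {R : realType} {n : nat} (M r eps beta delta : R)
    (T : nat) {d : measure_display} {W : measurableType d}
    (P : probability W R) (A : W -> algorithm 'rV[R]_n R) :
  (0 < n)%N -> 0 < M -> 0 < r -> 0 < eps -> 3 * eps <= M * r ->
  beta < 1 / 2 -> 3 * eps <= delta ->
  ~ solves (ball2 n r) (convex_lipschitz n M r) eps beta delta T P A.
Proof.
move=> n0 M0 r0 eps0 Mr beta2 delta1 sol.
pose w : 'rV[R]_n := sign_vector [ffun=> false].
have w1 : norm2 w = 1 by exact: norm2_sign_vector.
pose k := 3 * eps / r.
have k0 : 0 <= k by rewrite divr_ge0 ?mulr_ge0// ltW.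
have kr : k * r = 3 * eps by rewrite /k divfK ?gt_eqF.
pose f (s : bool) (x : 'rV[R]_n) : R :=  (-1) ^+ s * k * dot w x.
have Ff s : convex_lipschitz n M r (f s).
  apply: linear_convex_lipschitz; first by rewrite w1.
  by rewrite normrM normr_sign mul1r ger0_norm// ler_pdivrMr.
have Of s : noisy_oracle (ball2 n r) delta (f s) (fun=> 0).
  move=> x xr; rewrite sub0r normrN /f -mulrA normrMsign normrM (ger0_norm k0).
  apply: le_trans delta1; rewrite -kr ler_wpM2l//.
  by apply: le_trans xr; apply: normr_dot_le_norm2; rewrite w1.
suff : #|{: bool}|%:R * (1 - beta) <= 1 by rewrite card_bool; lra.
apply: (solves_sum_le f (fun _ _ => 0) 1 sol Ff Of).
move=> a _; set x := run _ a; rewrite big_bool/=.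
have le_inf s : inf (f s @` ball2 n r) <= - (3 * eps).
  have rw : ball2 n r ((- (-1) ^+ s * r) *: w).
    rewrite /ball2/= norm2Z w1 mulr1 normrM normrN normr_sign mul1r.
    by rewrite ger0_norm// ltW.
  apply: le_trans (inf_image_le M r (f s) _ (ltW M0) (Ff s) rw) _.
  rewrite /f dotZr dotxx w1 expr1n mulr1 -kr le_eqVlt; apply/orP; left.
  by apply/eqP; case: s {rw}; rewrite ?expr0 ?expr1; ring.
(* An [eps]-optimal value is at most [- 2 * eps], which cannot hold for two opposite numbers; so the
   common output serves at most one sign. *)
have := le_inf true; have := le_inf false.
have : f true x = - f false x by rewrite /f expr1 expr0; ring.
case: (leP (f true x - _)) => h1; case: (leP (f false x - _)) => h2;
  rewrite ?addr0 ?add0r//=; lra.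
Qed.

(** * Choice of the angle and the final rate *)

Lemma max_noise_le {R : realType} {n : nat} (M r eps t beta delta : R)
    (T : nat) :
  (0 < n)%N -> 0 < M -> 0 < r -> 0 < eps -> 6 * eps <= M * r ->
  0 < t -> beta < 1 / 2 ->
  4 * T.+1%:R * expR (- (n%:R * t ^+ 2 / 8)) <= 1 ->
  48 * eps ^+ 2 * t / (r * M) <= delta -> 108 * eps * t ^+ 2 <= delta ->
  (max_noise (ball2 n r) (convex_lipschitz n M r) eps beta T <= delta%:E)%E.
Proof.
move=> n0 M0 r0 eps0 Mr t0 beta2 Te delta1 delta2.
apply: ge_ereal_sup => _ [delta' [_ [d [W [P [A sol]]]]] <-].
rewrite lee_fin leNgt; apply/negP => lt_delta.
have et0 : 0 <= eps * t ^+ 2 by rewrite mulr_ge0 ?sqr_ge0// ltW.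
have [t6|t6] := leP t (1 / 6).
  by apply: (not_solves_small_angle M r eps t beta delta' T P A) => //; lra.
apply: (not_solves_large_noise M r eps beta delta' T P A) => //; first lra.
have t2 : 1 / 36 <= t ^+ 2 by nra.
have := ler_wpM2l (ltW eps0) t2; lra.
Qed.

(** The free [l] is to be instantiated with the logarithm of each of the two final bounds. *)
Lemma max_noise_le_rate {R : realType} {n : nat} (c M r eps beta l : R)
    (T : nat) :
  1 <= c -> (0 < n)%N -> 0 < M -> 0 < r -> 0 < eps -> 6 * eps <= M * r ->
  beta < 1 / 2 ->
  4 * T.+1%:R <= (2 * n%:R * M * r / eps) `^ c ->
  1 <= l -> ln (2 * n%:R * M * r / eps) <= 2 * l ->
  (max_noise (ball2 n r) (convex_lipschitz n M r) eps beta T <=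
   (1728 * c * l * Num.max (eps ^+ 2 / (Num.sqrt n%:R * M * r))
                           (eps / n%:R))%:E)%E.
Proof.
move=> c1 n0 M0 r0 eps0 Mr beta2 Tc l1 Ll.
set Q := 2 * n%:R * M * r / eps in Tc Ll *.
have nR : 0 < n%:R :> R by rewrite ltr0n.
have n1 : 1 <= n%:R :> R by rewrite ler1n.
have Q1 : 1 < Q.
  by rewrite /Q ltr_pdivlMr// mul1r; nra.
have lnQ0 : 0 < ln Q by rewrite ln_gt0.
have c0 : 0 < c by lra.
set q := Num.sqrt n%:R.
have q0 : 0 < q by rewrite sqrtr_gt0.
have qq : q ^+ 2 = n%:R by rewrite sqr_sqrtr// ltW.
(* With this choice the tail [expR (- (n * t ^+ 2 / 8))] is exactly the inverse of [Q] to the power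
   [c], matching the bound on [T]. *)
pose t := Num.sqrt (8 * c * ln Q / n%:R).
have t0 : 0 < t by rewrite sqrtr_gt0 divr_gt0// !mulr_gt0.
have tt : t ^+ 2 = 8 * c * ln Q / n%:R.
  by rewrite sqr_sqrtr// ltW// -sqrtr_gt0.
have cl1 : 1 <= c * l by rewrite mulr_ege1.
have t2_le : t ^+ 2 <= 16 * (c * l) / n%:R.
  rewrite tt ler_wpM2r ?invr_ge0 ?(ltW nR)//.
  by have := ler_wpM2l (ltW c0) Ll; lra.
(* The root of [c * l] is replaced by [c * l] itself, as [1 <= c * l]. The constants below are then
   [48 * 4 = 192] and [108 * 16 = 1728]. *)
have t_le : t <= 4 * (c * l) / q.
  rewrite -(ler_pXn2r (n := 2))// ?nnegrE ?divr_ge0 ?mulr_ge0 ?(ltW t0)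
    ?(ltW q0)//; [|lra..].
  apply: le_trans t2_le _; rewrite exprMn exprVn qq.
  rewrite ler_wpM2r ?invr_ge0 ?(ltW nR)//.
  have : 0 <= (c * l) * (c * l - 1) by rewrite mulr_ge0//; lra.
  lra.
set a := eps ^+ 2 / (q * M * r); set b := eps / n%:R.
have le_a : a <= Num.max a b by rewrite le_max lexx.
have le_b : b <= Num.max a b by rewrite le_max lexx orbT.
have a0 : 0 <= a by rewrite divr_ge0 ?sqr_ge0 ?mulr_ge0// ltW.
have b0 : 0 <= b by rewrite divr_ge0// ltW.
have cl0 : 0 <= c * l by lra.
apply: (max_noise_le M r eps t) => //.
- rewrite tt.
  have -> : n%:R * (8 * c * ln Q / n%:R) / 8 = c * ln Q.
    by field; rewrite gt_eqF.
  have -> : expR (- (c * ln Q)) = (Q `^ c)^-1.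
    by rewrite expRN /powR gt_eqF// (lt_trans _ Q1).
  by rewrite ler_pdivrMr ?mul1r// powR_gt0// (lt_trans _ Q1).
- apply: (@le_trans _ _ (192 * (c * l) * a)).
    rewrite (_ : 192 * (c * l) * a =
        48 * eps ^+ 2 / (r * M) * (4 * (c * l) / q)).
      rewrite [leLHS]mulrAC ler_wpM2l// divr_ge0 ?mulr_ge0 ?sqr_ge0//; exact: ltW.
    by rewrite /a; field; rewrite !gt_eqF.
  have := ler_wpM2l cl0 le_a; have := mulr_ge0 cl0 a0; lra.
- apply: (@le_trans _ _ (1728 * (c * l) * b)).
    rewrite (_ : 1728 * (c * l) * b = 108 * eps * (16 * (c * l) / n%:R)).
      by rewrite ler_wpM2l// mulr_ge0// ltW.
    by rewrite /b; field; rewrite gt_eqF.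
  have := ler_wpM2l cl0 le_b; lra.
Qed.

(** [e <= 4] is the square of [expR (1 / 2) <= 2], which follows from
    [1 - 1 / 2 <= expR (- (1 / 2))]. *)
Lemma ln_ge1 {R : realType} (x : R) : 4 <= x -> 1 <= ln x.
Proof.
move=> x4; have x0 : 0 < x by lra.
rewrite -ler_expR lnK ?posrE//; apply: le_trans x4.
have h : expR (1 / 2) <= 2 :> R.
  have := expR_ge1Dx (- (1 / 2) : R); rewrite expRN => h.
  rewrite -[leLHS]invrK -[leRHS]invrK lef_pV2 ?posrE ?invr_gt0 ?expR_gt0//.
  lra.
rewrite (_ : 1 = 1 / 2 + 1 / 2); last by field.
rewrite expRD; have := expR_gt0 (1 / 2 : R); nra.
Qed.

Theorem mainTheorem1 (R : realType) (c : R) (hc : 1 <= c) :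
  exists (C0 C1 : R) (n0 : nat) (C2 : R) (p : nat),
    [/\ 0 < C0, 0 < C1, (0 < n0)%N, 0 < C2 &
    forall (beta : R), 0 < beta -> beta < 1 / 2 ->
    forall (n : nat -> nat) (M r eps : nat -> R) (T : nat -> nat),
      n k @[k --> \oo] --> \oo ->
      (forall k, (n0 <= n k)%N) ->
      (forall k, 0 < M k) ->
      (forall k, 0 < r k) ->
      (forall k, 0 < eps k) ->
      (forall k, eps k < M k * r k / C1) ->
      ((T k)%:R / ((2 * (n k)%:R * M k * r k / eps k) `^ c))
        @[k --> \oo] --> (0 : R) ->
      \forall k \near \oo,
        (max_noise (ball2 (n k) (r k)) (convex_lipschitz (n k) (M k) (r k))
            (eps k) beta (T k)
          <= (C0 * rate c (C1 * eps k) (M k) (2 * r k) (n k))%:E)%E /\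
        (max_noise (ball2 (n k) (r k)) (convex_lipschitz (n k) (M k) (r k))
            (eps k) beta (T k)
          <= (C2 * Num.max (eps k ^+ 2 / (Num.sqrt (n k)%:R * M k * r k))
                           (eps k / (n k)%:R)
                 * ln ((n k)%:R * M k * r k / eps k) ^+ p)%:E)%E].
Proof.
(* [C1 = 6] provides [6 * eps <= M * r]; together with [n0 = 6] it gives [36 <= n * M * r / eps],
   enough for all the logarithms below. *)
exists 1728, 6, 6%N, (1728 * c), 1%N; split; [lra|lra|by []|lra|].
move=> beta _ beta2 n M r eps T _ n6 M0 r0 eps0 Mr To.
(* The level [1 / 8] makes [4 * T] less than half of [Q] to the power [c]; the other half absorbs
   the [4] coming from [T.+1]. *)
have /cvgrPdist_lt /(_ (1 / 8)) := To.
have e8 : 0 < 1 / 8 :> R by [].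
move=> /(_ e8); apply: filterS => k.
move: (n6 k) (M0 k) (r0 k) (eps0 k) (Mr k).
move: (n k) (M k) (r k) (eps k) (T k) => {n6 M0 r0 eps0 Mr To}{}n {}M {}r {}eps {}T.
move=> n6 M0 r0 eps0 Mr; rewrite sub0r normrN.
set Q := 2 * n%:R * M * r / eps.
have n6R : 6 <= n%:R :> R by rewrite (ler_nat _ 6).
have n0 : (0 < n)%N by apply: leq_trans n6.
have nR : 0 < n%:R :> R by rewrite ltr0n.
have Mr6 : 6 * eps <= M * r by move: Mr; rewrite ltr_pdivlMr//; lra.
have QE : Q = 2 * (n%:R * M * r / eps) by rewrite /Q; field; rewrite gt_eqF.
have Q2 : 36 <= n%:R * M * r / eps.
  rewrite ler_pdivlMr// -mulrA (_ : 36 = 6 * 6) -?mulrA; last by ring.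
  by rewrite ler_pM// mulr_ge0// ltW.
have Q0 : 0 < Q by lra.
have Qc : Q <= Q `^ c by rewrite -[leLHS]powRr1 ?(ltW Q0)// ler_powR//; lra.
have Qc0 : 0 < Q `^ c by rewrite powR_gt0.
rewrite ger0_norm ?divr_ge0 ?powR_ge0// ltr_pdivrMr// => TQ.
have Tc : 4 * T.+1%:R <= Q `^ c by rewrite -natr1; lra.
set X := Num.max (eps ^+ 2 / (Num.sqrt n%:R * M * r)) (eps / n%:R).
have X0 : 0 <= X by rewrite le_max [X in _ || X]divr_ge0 ?orbT// ltW.
have bound l : 1 <= l -> ln Q <= 2 * l ->
    (max_noise (ball2 n r) (convex_lipschitz n M r) eps beta T <=
     (1728 * c * l * X)%:E)%E.
  exact: max_noise_le_rate.
split.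
  rewrite /rate; set l := ln _.
  have Q6 : n%:R * M * (2 * r) / (6 * eps) = Q / 6.
    by rewrite /Q; field; rewrite gt_eqF.
  have l1 : 1 <= l by rewrite /l Q6 ln_ge1//; lra.
  apply: le_trans (bound l l1 _) _.
    (* [ln Q = ln 6 + ln (Q / 6)], and [6 <= Q / 6]. *)
    rewrite (_ : Q = 6 * (Q / 6)); last by field.
    rewrite lnM ?posrE//; last lra.
    rewrite /l Q6 mulr_natl mulr2n lerD2r ler_ln ?posrE//; lra.
  set X' := Num.max _ (6 * eps / _).
  have XX' : X <= X'.
    rewrite /X /X' ge_max !le_max; apply/andP; split; apply/orP; [left|right].
      rewrite exprMn [leRHS](_ : _ = 18 * (eps ^+ 2 / (Num.sqrt n%:R * M * r))).
        rewrite ler_peMl// ?divr_ge0 ?sqr_ge0 ?mulr_ge0 ?(ltW M0) ?(ltW r0)//.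
        lra.
      by field; rewrite !gt_eqF ?sqrtr_gt0.
    by rewrite ler_wpM2r ?invr_ge0 ?ltW//; lra.
  have cl1 : 1 <= c * l by rewrite mulr_ege1.
  rewrite lee_fin (_ : 1728 * c * l * X = 1728 * (X * (c * l))); last by ring.
  rewrite ler_pM2l; last lra.
  apply: ler_pM => //; first lra.
  (* Since [1 <= c * l], the factor [c * l] is dominated by its square. *)
  have : 0 <= (c * l) * (c * l - 1) by apply: mulr_ge0; lra.
  lra.
rewrite expr1 mulrAC; apply: bound; first by rewrite ln_ge1//; lra.
rewrite QE lnM ?posrE//; last lra.
by rewrite [leRHS]mulr_natl mulr2n lerD2r ler_ln ?posrE//; lra.
Qed.
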